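(* There exists a function $K^T:\mathbb N\to\mathbb R$ such that for any field $\mathbb K$ the Tits building $T^{\mathbb K}_n$ is uniformly $(n-3)$-acyclic and satisfies the $q$-UBC for all $q\le n-3$ with constant $K^T(n)$. In particular, $\widetilde H^q_{\mathrm{b,s}}(T^{\mathbb K}_n;\mathbb R)=0$ if $q\ne n-2$.
   Context: Here $n\in\mathbb N=\{0,1,2,\dots\}$. For a field $\mathbb K$, the Tits building $T^{\mathbb K}_n$ of type $\mathtt A_{n-1}$ over $\mathbb K$ is the poset of proper, nontrivial subspaces $0\neq V\subsetneq\mathbb K^n$, ordered by inclusion. A poset is regarded as a semi-simplicial set via its order complex: $p$-simplices are chains $x_0\lneq\dots\lneq x_p$, and the $k$-th face omits $x_k$. For a semi-simplicial set $X_\bullet$ with face maps $d_i$, the real simplicial chain complex is $C_q(X_\bullet)=\mathbb R[X_q]$ with $\partial_q=\sum_{i=0}^q(-1)^id_i$, equipped with the $\ell^1$-norm. The reduced complex adds $\mathbb R$ (with the absolute value as norm) in degree $-1$, with $\partial_0$ sending every vertex to $1$. The reduced simplicial bounded cohomology $\widetilde H^q_{\mathrm{b,s}}(X_\bullet;\mathbb R)$ is the cohomology of the complex of bounded linear functionals on the reduced complex. A normed chain complex $C_*$ satisfies the $q$-uniform boundary condition ($q$-UBC) with constant $K$ if for every boundary $\sigma\in\partial_{q+1}(C_{q+1})$ there is $\rho\in C_{q+1}$ with $\partial\rho=\sigma$ and $\|\rho\|\le K\|\sigma\|$; if $\partial_{q+1}(C_{q+1})=\{0\}$, the constant is defined to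 be $0$. A semi-simplicial set satisfies the $q$-UBC if its simplicial chain complex does. For $m\ge-1$, a non-empty semi-simplicial set $X_\bullet$ is uniformly $m$-acyclic if its reduced real simplicial homology vanishes in all degrees $0\le q\le m$ and its simplicial chain complex $C_*(X_\bullet)$ satisfies the $q$-UBC for all $q\le m$. (So uniformly $(-1)$-acyclic means non-empty; for $m\le-2$ the condition is empty.)
   Formalization: The vanishing of the reduced simplicial bounded cohomology for q ≠ n−2 is stated except for n = 0, q = −1, where it fails: the Tits building is then empty and its reduced cohomology in degree −1 is ℝ. *)

(* Defs.v *)
From HB Require Import structures.
From mathcomp Require Import all_boot all_order all_algebra.
From mathcomp Require Import finmap zify.
From mathcomp Require Import reals.
From mathcomp.multinomials Require Import monalg.

Set Implicit Arguments.
Unset Strict Implicit.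
Unset Printing Implicit Defensive.

Import Order.TTheory GRing.Theory Num.Theory.
Local Open Scope ring_scope.

(* The identity [face i (face (j+1) x) = face j (face i x)] for [i <= j] is the
   usual [d_i d_j' = d_(j'-1) d_i] for [i < j'], with [j' = j + 1]. *)
Record semiSimplicialSet := SemiSimplicialSet {
  simplex :> nat -> choiceType;
  face : forall q, 'I_q.+2 -> simplex q.+1 -> simplex q;
  face_face : forall q (i j : 'I_q.+2) (x : simplex q.+2), (i <= j)%N ->
    face i (face (lift ord0 j) x) = face j (face (widen_ord (leqnSn _) i) x)
}.
Arguments face {s q}.

(* Non-negatively indexed.  Index and degree agree for the simplicial chain
   complex; for the reduced complex, index [k] is degree [k - 1]. *)
Record normedComplex (R : realType) := NormedComplex {
  chain :> nat -> lmodType R;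
  cnorm : forall k, chain k -> R;
  bd : forall k, {linear chain k.+1 -> chain k};
  bd_bd : forall k (c : chain k.+2), bd k (bd k.+1 c) = 0;
  cnorm_eq0 : forall k (c : chain k), cnorm c = 0 -> c = 0;
  cnormD : forall k (c c' : chain k), cnorm (c + c') <= cnorm c + cnorm c';
  cnormZ : forall k (a : R) (c : chain k), cnorm (a *: c) = `|a| * cnorm c;
  bd_bounded : forall k, exists M : R, forall c : chain k.+1,
    cnorm (bd k c) <= M * cnorm c
}.
Arguments cnorm {R n k}.
Arguments bd {R n k}.

Section NormedComplexes.
Variables (R : realType) (C : normedComplex R).

Definition is_cycle k : C k -> Prop :=
  match k with
  | 0 => fun=> True
  | k'.+1 => fun c => bd c = 0
  end.

Definition is_boundary k (c : C k) : Prop := exists b : C k.+1, bd b = c.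

Definition homology_vanishes (k : nat) : Prop :=
  forall c : C k, is_cycle c -> is_boundary c.

(* If the only boundary at index [q] is [0], this holds for every [K], in
   particular for [K = 0]. *)
Definition UBC (q : nat) (K : R) : Prop :=
  forall s : C q, is_boundary s ->
    exists r : C q.+1, bd r = s /\ cnorm r <= K * cnorm s.

Definition bounded_functional k (f : {linear C k -> R^o}) : Prop :=
  exists M : R, forall c : C k, `|f c : R| <= M * cnorm c.

Definition is_bcocycle k (f : {linear C k -> R^o}) : Prop :=
  bounded_functional f /\ forall c : C k.+1, f (bd c) = 0.

Definition is_bcoboundary k : {linear C k -> R^o} -> Prop :=
  match k with
  | 0 => fun f => forall c, f c = 0
  | k'.+1 => fun f => exists g : {linear C k' -> R^o},
      bounded_functional g /\ forall c, f c = g (bd c)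
  end.

Definition bcohomology_vanishes (k : nat) : Prop :=
  forall f : {linear C k -> R^o}, is_bcocycle f -> is_bcoboundary f.

End NormedComplexes.

Section Lift.
Variables (R : realType) (X : choiceType).

Definition lin_ext_fun (V : lmodType R) (h : X -> V) (c : {malg R[X]}) : V :=
  \sum_(x <- msupp c) c@_x *: h x.

Definition l1norm (c : {malg R[X]}) : R := \sum_(x <- msupp c) `|c@_x|.

Lemma sum_msuppw (V : nmodType) (F : X -> R -> V) (c : {malg R[X]})
    (d : {fset X}) : (forall x, F x 0 = 0) -> (msupp c `<=` d)%fset ->
  \sum_(x <- msupp c) F x c@_x = \sum_(x <- d) F x c@_x.
Proof.
move=> F0 le_d; rewrite (big_fset_incl _ le_d) //= => x _ xNc.
by rewrite mcoeff_outdom.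
Qed.

Lemma lin_ext_is_linear (V : lmodType R) (h : X -> V) :
  linear (lin_ext_fun h).
Proof.
move=> a c c'; pose d := (msupp c `|` msupp c')%fset.
have F0 x : (0 : R) *: h x = 0 by rewrite scale0r.
have ledl : (msupp c `<=` d)%fset by apply: fsubsetUl.
have ledr : (msupp c' `<=` d)%fset by apply: fsubsetUr.
have led : (msupp (a *: c + c') `<=` d)%fset.
  apply: (fsubset_trans (msuppD_le _ _)); apply: fsetSU.
  exact: msuppZ_le.
rewrite /lin_ext_fun.
rewrite (sum_msuppw (F := fun x r => r *: h x) F0 led).
rewrite (sum_msuppw (F := fun x r => r *: h x) F0 ledl).
rewrite (sum_msuppw (F := fun x r => r *: h x) F0 ledr).
rewrite scaler_sumr -big_split /=; apply: eq_bigr => x _.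
by rewrite mcoeffD mcoeffZ scalerDl scalerA.
Qed.

HB.instance Definition _ (V : lmodType R) (h : X -> V) :=
  GRing.isLinear.Build R {malg R[X]} V _ (lin_ext_fun h) (lin_ext_is_linear h).

Definition lin_ext (V : lmodType R) (h : X -> V) : {linear {malg R[X]} -> V} :=
  lin_ext_fun h.

Lemma lin_extU (V : lmodType R) (h : X -> V) (x : X) :
  lin_ext h << x >> = h x.
Proof.
by rewrite /lin_ext /= /lin_ext_fun msuppU oner_eq0 big_seq_fset1 mcoeffUU scale1r.
Qed.

Lemma l1norm_eq0 (c : {malg R[X]}) : l1norm c = 0 -> c = 0.
Proof.
move=> c0; apply/malgP => x; rewrite mcoeff0.
case: msuppP => // xc; apply/eqP; rewrite -normr_eq0; apply/eqP.
move/eqP: c0; rewrite psumr_eq0; last by move=> *; exact: normr_ge0.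
by move/allP/(_ x xc)/eqP.
Qed.

Lemma l1normD (c c' : {malg R[X]}) : l1norm (c + c') <= l1norm c + l1norm c'.
Proof.
pose d := (msupp c `|` msupp c')%fset.
have F0 (x : X) : `|0 : R| = 0 by rewrite normr0.
have ledl : (msupp c `<=` d)%fset by apply: fsubsetUl.
have ledr : (msupp c' `<=` d)%fset by apply: fsubsetUr.
have led : (msupp (c + c') `<=` d)%fset by exact: msuppD_le.
rewrite /l1norm.
rewrite (sum_msuppw (F := fun x r => `|r|) F0 led).
rewrite (sum_msuppw (F := fun x r => `|r|) F0 ledl).
rewrite (sum_msuppw (F := fun x r => `|r|) F0 ledr).
rewrite -big_split /=; apply: ler_sum => x _.
by rewrite mcoeffD ler_normD.
Qed.

Lemma l1normZ (a : R) (c : {malg R[X]}) : l1norm (a *: c) = `|a| * l1norm c.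
Proof.
rewrite /l1norm.
have F0 (x : X) : `|0 : R| = 0 by rewrite normr0.
rewrite (sum_msuppw (F := fun x r => `|r|) F0 (msuppZ_le a c)).
rewrite mulr_sumr; apply: eq_bigr => x _.
by rewrite mcoeffZ normrM.
Qed.

Lemma l1norm0 : l1norm 0 = 0.
Proof. by rewrite /l1norm msupp0 big_seq_fset0. Qed.

Lemma l1norm_sum (I : Type) (r : seq I) (F : I -> {malg R[X]}) :
  l1norm (\sum_(i <- r) F i) <= \sum_(i <- r) l1norm (F i).
Proof.
elim: r => [|i r IH]; first by rewrite !big_nil l1norm0.
by rewrite !big_cons (le_trans (l1normD _ _)) // lerD2l.
Qed.

Lemma l1normU (x : X) : l1norm << x >> = 1.
Proof. by rewrite /l1norm msuppU oner_eq0 big_seq_fset1 mcoeffUU normr1. Qed.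

End Lift.

Section SimplicialChains.
Variables (R : realType) (X : semiSimplicialSet).

Definition sbd q : {linear {malg R[X q.+1]} -> {malg R[X q]}} :=
  lin_ext (fun x : X q.+1 =>
    \sum_(i < q.+2) (-1) ^+ i *: << face i x >> : {malg R[X q]}).

Lemma sbdU q (x : X q.+1) :
  sbd q << x >> = \sum_(i < q.+2) (-1) ^+ i *: << face i x >>.
Proof. by rewrite /sbd lin_extU. Qed.

Lemma linear_ext0 (Y : choiceType) (V : lmodType R)
    (f : {linear {malg R[Y]} -> V}) :
  (forall y, f << y >> = 0) -> forall c, f c = 0.
Proof.
move=> f0 c; rewrite (monalgE c) linear_sum big1_seq // => y _.
have -> : << c@_y *g y >> = c@_y *: << y >> :> {malg R[Y]}.
  by apply/malgP => z; rewrite mcoeffZ !mcoeffU mulr_natr.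
by rewrite linearZ /= f0 scaler0.
Qed.

Lemma sbd_sbd q (c : {malg R[X q.+2]}) : sbd q (sbd q.+1 c) = 0.
Proof.
pose f : {linear {malg R[X q.+2]} -> {malg R[X q]}} := sbd q \o sbd q.+1.
rewrite -[LHS]/(f c); apply: (@linear_ext0 _ _ f) => {c} x.
rewrite /f /= sbdU linear_sum /=.
pose F (j : 'I_q.+3) (i : 'I_q.+2) : {malg R[X q]} :=
  ((-1) ^+ j * (-1) ^+ i) *: << face i (face j x) >>.
rewrite (eq_bigr (fun j => \sum_(i < q.+2) F j i)); last first.
  move=> j _; rewrite linearZ /= sbdU scaler_sumr.
  by apply: eq_bigr => i _; rewrite scalerA.
rewrite (eq_bigr (fun j : 'I_q.+3 =>
  \sum_(i < q.+2 | (i < j)%N) F j i + \sum_(i < q.+2 | (j <= i)%N) F j i));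
  last first.
  move=> j _; rewrite (bigID (fun i : 'I_q.+2 => (i < j)%N)) /=.
  by congr (_ + _); apply: eq_bigl => i; rewrite -leqNgt.
rewrite big_split /= big_ord_recl big_pred0 // add0r.
rewrite [X in _ + X]big_ord_recr /= [X in _ + (_ + X)]big_pred0; last first.
  by move=> i; rewrite leqNgt ltn_ord.
rewrite addr0.
under eq_bigr do rewrite big_mkcond.
rewrite exchange_big -big_split big1 //= => i _.
rewrite -big_mkcond /= (eq_bigl (fun k : 'I_q.+2 => (i <= k)%N)) => [|k]//.
rewrite -big_split big1 //= => k le_ik.
by rewrite /F face_face //= /bump /= exprD expr1 mulN1r mulNr scaleNr mulrC addNr.
Qed.

Lemma l1norm_lin_ext (Y Z : choiceType) (h : Y -> {malg R[Z]}) (M : R) :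
  (forall y, l1norm (h y) <= M) ->
  forall c, l1norm (lin_ext h c) <= M * l1norm c.
Proof.
move=> hM c; apply: (le_trans (l1norm_sum _ _)).
rewrite /l1norm mulr_sumr; apply: ler_sum => y _.
by rewrite -/(l1norm _) l1normZ mulrC ler_wpM2r.
Qed.

Lemma sbd_bounded q : exists M : R, forall c : {malg R[X q.+1]},
  l1norm (sbd q c) <= M * l1norm c.
Proof.
exists (q.+2)%:R; apply: l1norm_lin_ext => x.
apply: (le_trans (l1norm_sum _ _)).
rewrite (eq_bigr (fun=> 1)) ?sumr_const ?card_ord // => i _.
by rewrite l1normZ l1normU mulr1 normrX normrN1 expr1n.
Qed.

Definition simplicialComplex : normedComplex R :=
  @NormedComplex R (fun q => {malg R[X q]}) (fun q => @l1norm R (X q)) sbd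
    sbd_sbd (fun q => @l1norm_eq0 R (X q)) (fun q => @l1normD R (X q))
    (fun q => @l1normZ R (X q)) sbd_bounded.

Definition augmentation : {linear {malg R[X 0]} -> R^o} :=
  lin_ext (fun=> 1 : R^o).

Lemma augmentation_sbd (c : {malg R[X 1]}) : augmentation (sbd 0 c) = 0.
Proof.
pose f : {linear {malg R[X 1]} -> R^o} := augmentation \o sbd 0.
rewrite -[LHS]/(f c); apply: (@linear_ext0 _ _ f) => {c} x.
rewrite /f /= sbdU !big_ord_recl big_ord0 addr0 linearD !linearZ /=.
rewrite /augmentation !lin_extU.
by rewrite expr0 expr1 scale1r scaleN1r subrr.
Qed.

Definition rchain (k : nat) : lmodType R :=
  match k with
  | 0 => R^o
  | q.+1 => {malg R[X q]}
  end.

Definition rnorm (k : nat) : rchain k -> R :=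
  match k with
  | 0 => fun a : R => `|a|
  | q.+1 => @l1norm R (X q)
  end.

Definition rbd (k : nat) : {linear rchain k.+1 -> rchain k} :=
  match k with
  | 0 => augmentation
  | q.+1 => sbd q
  end.

Lemma rbd_rbd k (c : rchain k.+2) : rbd k (rbd k.+1 c) = 0.
Proof. by case: k c => [|k] c; [apply: augmentation_sbd | apply: sbd_sbd]. Qed.

Lemma rnorm_eq0 k (c : rchain k) : rnorm c = 0 -> c = 0.
Proof. by case: k c => [|k] c; [apply: normr0_eq0 | apply: l1norm_eq0]. Qed.

Lemma rnormD k (c c' : rchain k) : rnorm (c + c') <= rnorm c + rnorm c'.
Proof. by case: k c c' => [|k] c c'; [apply: ler_normD | apply: l1normD]. Qed.

Lemma rnormZ k (a : R) (c : rchain k) : rnorm (a *: c) = `|a| * rnorm c.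
Proof. by case: k c => [|k] c; [apply: normrM | apply: l1normZ]. Qed.

Lemma rbd_bounded k : exists M : R, forall c : rchain k.+1,
  rnorm (rbd k c) <= M * rnorm c.
Proof.
case: k => [|k] /=; last exact: sbd_bounded.
exists 1 => c; rewrite mul1r /augmentation /lin_ext /= /lin_ext_fun.
apply: (le_trans (ler_norm_sum _ _ _)); apply: ler_sum => x _.
by rewrite normrM normr1 mulr1.
Qed.

Definition reducedComplex : normedComplex R :=
  NormedComplex rbd_rbd rnorm_eq0 rnormD rnormZ rbd_bounded.

End SimplicialChains.

Section Acyclicity.
Variables (R : realType) (X : semiSimplicialSet).

Definition sset_UBC (q : nat) (K : R) : Prop := UBC (simplicialComplex R X) q K.

Definition reduced_homology_vanishes (q : nat) : Prop :=
  homology_vanishes (reducedComplex R X) q.+1.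

(* [q] ranges over the integers because of degree [-1]; the reduced complex is
   zero below that degree. *)
Definition reduced_bcohomology_vanishes (q : int) : Prop :=
  forall k : nat, k%:Z = q + 1 -> bcohomology_vanishes (reducedComplex R X) k.

(* The unreduced complex is zero in negative degrees, where the uniform boundary
   condition is void. *)
Definition uniformly_acyclic (m : int) : Prop :=
  - 1 <= m ->
    inhabited (X 0) /\
    forall q : nat, q%:Z <= m ->
      reduced_homology_vanishes q /\ exists K : R, sset_UBC q K.

End Acyclicity.

Section OrderComplex.
Variables (d : Order.disp_t) (P : porderType d).

Definition is_chain p (x : {ffun 'I_p.+1 -> P}) : bool :=
  [forall i : 'I_p.+1, forall j : 'I_p.+1, (i < j)%N ==> (x i < x j)%O].

Definition ochain p := {x : {ffun 'I_p.+1 -> P} | is_chain x}.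
HB.instance Definition _ p := Choice.on (ochain p).

Definition omit p (k : 'I_p.+2) (x : {ffun 'I_p.+2 -> P}) :
  {ffun 'I_p.+1 -> P} := [ffun i => x (lift k i)].

Lemma omit_chain p (k : 'I_p.+2) (x : ochain p.+1) : is_chain (omit k (val x)).
Proof.
apply/forallP => i; apply/forallP => j; apply/implyP => ltij.
rewrite !ffunE; case: x => x /= /forallP /(_ (lift k i)) /forallP.
move=> /(_ (lift k j)) /implyP; apply.
by rewrite /= /bump; case: leqP; case: leqP => *; lia.
Qed.

Definition oface p (k : 'I_p.+2) (x : ochain p.+1) : ochain p :=
  Sub (omit k (val x)) (omit_chain k x).

Lemma oface_oface p (i j : 'I_p.+2) (x : ochain p.+2) : (i <= j)%N ->
  oface i (oface (lift ord0 j) x) = oface j (oface (widen_ord (leqnSn _) i) x).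
Proof.
move=> le_ij; apply: val_inj; apply/ffunP => l; rewrite !ffunE /=.
congr (val x _); apply: val_inj; rewrite /= /bump /=.
by repeat case: leqP => *; lia.
Qed.

Definition order_complex : semiSimplicialSet :=
  SemiSimplicialSet oface_oface.

End OrderComplex.

Fact tits_display : Order.disp_t. Proof. exact: Order.Disp tt tt. Qed.

Section Tits.
Variables (K : fieldType) (n : nat).

Definition proper_nontrivial (V : {vspace 'rV[K]_n}) : bool :=
  (V != 0%VS) && (V != fullv).

Definition tits := {V : {vspace 'rV[K]_n} | proper_nontrivial V}.
HB.instance Definition _ := Choice.on tits.

Definition tits_le (V W : tits) : bool := (val V <= val W)%VS.

Lemma tits_le_refl : reflexive tits_le.
Proof. by move=> V; apply: subvv. Qed.

Lemma tits_le_anti : antisymmetric tits_le.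
Proof. by move=> V W VW; apply: val_inj; apply: subv_anti. Qed.

Lemma tits_le_trans : transitive tits_le.
Proof. by move=> V W U; apply: subv_trans. Qed.

HB.instance Definition _ := Order.Le_isPOrder.Build tits_display tits
  tits_le_refl tits_le_anti tits_le_trans.

Definition tits_building : semiSimplicialSet := order_complex tits.

End Tits.

(* Main.v *)
From HB Require Import structures.
Require Import Defs.
From mathcomp Require Import all_boot all_order all_algebra.
From mathcomp Require Import finmap zify boolp reals.
From mathcomp.multinomials Require Import monalg.

Set Implicit Arguments.
Unset Strict Implicit.
Unset Printing Implicit Defensive.

Import Order.TTheory GRing.Theory Num.Theory.
Local Open Scope ring_scope.

(** The reduced chain complex of the building carries an explicit linear
    homotopy h that contracts it in degrees at most n - 3 and whose operator
    norm is at most (n + 1)!.  Such an h gives everything at once: a cycle c is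
    the boundary of h c, which is acyclicity together with the uniform boundary
    condition ([contracts_homology], [contracts_UBC]), and a bounded cocycle f
    is the coboundary of the bounded functional f o h
    ([contracts_bcohomology]), so that no extension of functionals is needed.
    In degrees above n - 2 there are no simplices.

    The homotopy is built by induction on the dimension of V, for the poset of
    subspaces strictly between 0 and V.  Fix a line L in V.  A proper subspace W
    with W + L = V is a hyperplane, and a flag has at most one such member, its
    largest one.  The flags without such a member form a subcomplex Y, which is
    conically contractible through W <= W + L >= L; the operator [cone] realizes
    this and multiplies the norm of a flag of s subspaces by at most s + 1.
    The full complex is Y with, for every hyperplane W complementary to L, a
    cone with apex W glued along the complex of W.  The homotopy h_W given by
    induction pushes that cone into Y, which leads to the formulas
      h_V s        = cone s                        for s in Y,
      h_V (W :: s) = cone (h_W s) - W :: h_W s     for W + L = V.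
    The complexes of distinct W do not interact, so the bound on the norm is
    independent of the number of hyperplanes, hence of the field
    ([contract_contracts]).

    The argument uses only joins, a rank, and an atom below every nonzero
    element whose join with any element raises the rank by at most one; it is
    carried out in that generality.  Flags are decreasing sequences, the largest
    member first, so that both formulas are recursions on lists and the empty
    flag provides the augmentation.  *)

(** * Chains supported on a predicate *)

Section Supported.
Variables (R : realType) (X : choiceType).
Implicit Types (P Q : pred X) (c : {malg R[X]}).

Definition supported P c : Prop := forall x, x \in msupp c -> P x.

Lemma supported0 P : supported P 0.
Proof. by move=> x; rewrite msupp0 in_fset0. Qed.

Lemma supportedU P x : P x -> supported P << x >>.
Proof. by move=> Px y; rewrite msuppU oner_eq0 in_fset1 => /eqP ->. Qed.

Lemma supportedN P c : supported P c -> supported P (- c).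
Proof. by rewrite /supported msuppN. Qed.

Lemma supportedD P c c' :
  supported P c -> supported P c' -> supported P (c + c').
Proof.
move=> Pc Pc' x /(fsubsetP (msuppD_le c c')).
by rewrite in_fsetU => /orP[]; [apply: Pc | apply: Pc'].
Qed.

Lemma supportedZ P a c : supported P c -> supported P (a *: c).
Proof. by move=> Pc x /(fsubsetP (msuppZ_le a c)) /Pc. Qed.

Lemma supported_sub P Q c :
  (forall x, P x -> Q x) -> supported P c -> supported Q c.
Proof. by move=> PQ Pc x /Pc /PQ. Qed.

Lemma chain_sum c : c = \sum_(x <- msupp c) c@_x *: << x >>.
Proof.
rewrite [LHS]monalgE; apply: eq_bigr => x _.
by apply/malgP => z; rewrite mcoeffZ !mcoeffU mulr_natr.
Qed.

Lemma eq_supported (V : lmodType R) (f g : {linear {malg R[X]} -> V}) P c :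
  supported P c -> (forall x, P x -> f << x >> = g << x >>) -> f c = g c.
Proof.
move=> Pc fg; rewrite [c]chain_sum !linear_sum.
apply: eq_big_seq => x /Pc Px.
by rewrite !linearZ /= fg.
Qed.

Lemma eq_linear_basis (V : lmodType R) (f g : {linear {malg R[X]} -> V}) c :
  (forall x, f << x >> = g << x >>) -> f c = g c.
Proof. by move=> fg; apply: (@eq_supported _ _ _ predT). Qed.

End Supported.

Lemma supported_lin_ext (R : realType) (X Y : choiceType) (P : pred X)
    (Q : pred Y) (h : X -> {malg R[Y]}) c :
  supported P c -> (forall x, P x -> supported Q (h x)) ->
  supported Q (lin_ext h c).
Proof.
move=> Pc Qh; rewrite [c]chain_sum linear_sum /= big_seq.
apply: big_ind => [|? ? ? ?|x /Pc Px]; [exact: supported0|exact: supportedD|].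
by rewrite linearZ; apply/supportedZ; rewrite lin_extU; apply: Qh.
Qed.

Lemma l1norm_lin_ext_supported (R : realType) (X Y : choiceType) (P : pred X)
    (h : X -> {malg R[Y]}) (M : R) c :
  supported P c -> (forall x, P x -> l1norm (h x) <= M) ->
  l1norm (lin_ext h c) <= M * l1norm c.
Proof.
move=> Pc hM; apply: (le_trans (l1norm_sum _ _)).
rewrite [X in _ * X]/l1norm mulr_sumr big_seq [leRHS]big_seq.
apply: ler_sum => x /Pc Px.
by rewrite l1normZ mulrC ler_wpM2r // hM.
Qed.

Lemma l1normN (R : realType) (X : choiceType) (c : {malg R[X]}) :
  l1norm (- c) = l1norm c.
Proof. by rewrite -scaleN1r l1normZ normrN1 mul1r. Qed.

(** * Chains of words *)

Section SequenceChains.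
Variables (R : realType) (T : choiceType).
Local Notation chains := {malg R[seq T]}.
Implicit Types (x : T) (s t : seq T) (c : chains).

Definition consl x : {linear chains -> chains} :=
  locked (lin_ext (fun s => << x :: s >> : chains)).

(** Writing the alternating sum of faces as a recursion keeps the cone identity
    d (x :: s) = s - x :: d s immediate; [seqbd_del] recovers the sum.  The
    boundary of a one-letter word is the empty word, as in the augmented
    complex. *)
Fixpoint seq_faces s : chains :=
  if s is x :: s' then << s' >> - consl x (seq_faces s') else 0.

Definition seqbd : {linear chains -> chains} :=
  locked (lin_ext seq_faces).

(** Prepending in the normalized complex, where a word with a repeated letter
    counts as zero: the conical contraction compares s with W + L, and W + L
    may coincide with a member already present. *)
Definition consn x : {linear chains -> chains} :=
  locked (lin_ext
    (fun s => if ohead s == Some x then 0 else << x :: s >> : chains)).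

Lemma conslU x s : consl x << s >> = << x :: s >>.
Proof. by rewrite /consl -lock lin_extU. Qed.

Lemma seqbdU s : seqbd << s >> = seq_faces s.
Proof. by rewrite /seqbd -lock lin_extU. Qed.

Lemma consnU x s :
  consn x << s >> = if ohead s == Some x then 0 else << x :: s >>.
Proof. by rewrite /consn -lock lin_extU. Qed.

Lemma seqbd_cons x s : seqbd << x :: s >> = << s >> - consl x (seqbd << s >>).
Proof. by rewrite !seqbdU. Qed.

Lemma seqbd_consl x c : seqbd (consl x c) = c - consl x (seqbd c).
Proof.
pose f : {linear chains -> chains} := seqbd \o consl x.
pose g : {linear chains -> chains} := idfun \- (consl x \o seqbd).
apply: (@eq_linear_basis _ _ _ f g) => s /=.
by rewrite conslU seqbd_cons.
Qed.

Lemma consn_consl x c : consn x (consl x c) = 0.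
Proof.
pose f : {linear chains -> chains} := consn x \o consl x.
apply: (@linear_ext0 _ _ _ f) => s.
by rewrite /f /= conslU consnU /= eqxx.
Qed.

Lemma consl_supported (P Q : pred (seq T)) x c : supported P c ->
  (forall s, P s -> Q (x :: s)) -> supported Q (consl x c).
Proof.
move=> Pc PQ; rewrite /consl -lock.
by apply: (supported_lin_ext Pc) => s /PQ; apply: supportedU.
Qed.

Lemma consn_supported (P Q : pred (seq T)) x c : supported P c ->
  (forall s, P s -> ohead s != Some x -> Q (x :: s)) ->
  supported Q (consn x c).
Proof.
move=> Pc PQ; rewrite /consn -lock; apply: (supported_lin_ext Pc) => s Ps.
case: ifPn => [_|nx]; first exact: supported0.
by apply: supportedU; apply: PQ.
Qed.

Lemma consl_norm x c : l1norm (consl x c) <= l1norm c.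
Proof.
rewrite -[leRHS]mul1r /consl -lock; apply: l1norm_lin_ext => s.
by rewrite l1normU.
Qed.

Lemma consn_norm x c : l1norm (consn x c) <= l1norm c.
Proof.
rewrite -[leRHS]mul1r /consn -lock; apply: l1norm_lin_ext => s.
by case: ifP => _; rewrite ?l1norm0 ?l1normU.
Qed.

Definition del i s := take i s ++ drop i.+1 s.

Lemma size_del i s : (i < size s)%N -> size (del i s) = (size s).-1.
Proof. by move=> lt_i; rewrite size_cat size_drop size_take lt_i; lia. Qed.

Lemma nth_del x i s j : (i < size s)%N ->
  nth x (del i s) j = nth x s (bump i j).
Proof.
move=> lt_i; rewrite nth_cat size_take lt_i /bump.
case: ltnP => ij; first by rewrite nth_take.
by rewrite nth_drop; congr nth; lia.
Qed.

Lemma seqbd_del s :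
  seqbd << s >> = \sum_(i < size s) (-1) ^+ i *: << del i s >>.
Proof.
elim: s => [|x s IHs]; first by rewrite seqbdU big_ord0.
rewrite seqbd_cons IHs big_ord_recl expr0 scale1r /= /del take0 /= drop0.
congr (_ + _); rewrite (linear_sum (consl x)) -sumrN; apply: eq_bigr => i _ /=.
by rewrite linearZ /= conslU /bump exprS mulN1r scaleNr.
Qed.

End SequenceChains.
Arguments consl {R T}.
Arguments consn {R T}.
Arguments seqbd {R T}.
Arguments seq_faces {R T}.

(** * Contracting flags in a ranked join semilattice *)

Section Contraction.
Variables (R : realType) (disp : Order.disp_t) (T : bJoinSemilatticeType disp).
Local Notation chains := {malg R[seq T]}.
Local Open Scope order_scope.
Implicit Types (U V W L : T) (s t : seq T) (c : chains).

Definition above V W := (W < V) && (W != \bot).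
Definition flag V s := path above V s.
Definition wflag V s :=
  if s is W :: s' then [&& W <= V, W != \bot & flag W s'] else true.

Lemma above_trans : transitive above.
Proof.
move=> V U W /andP[VU V0] /andP[WV W0].
by rewrite /above W0 (lt_trans WV VU).
Qed.

Lemma flag_wflag V s : flag V s -> wflag V s.
Proof. by case: s => //= W s /andP[/andP[/ltW -> ->]]. Qed.

Lemma wflagS U V s : U <= V -> wflag U s -> wflag V s.
Proof. by case: s => //= W s UV /and3P[/le_trans -> // -> ->]. Qed.

Lemma wflag_flag U V s : U < V -> wflag U s -> flag V s.
Proof.
case: s => //= W s UV /and3P[WU W0 ->].
by rewrite /above W0 (le_lt_trans WU UV).
Qed.

(** Dropping degenerate words is compatible with the cone identity: if U is the
    head of s, both sides vanish, since the face of s that omits U gives back s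
    itself and the other faces become degenerate. *)
Lemma seqbd_consn U c : supported (wflag U) c ->
  seqbd (consn U c) = c - consn U (seqbd c).
Proof.
pose f : {linear chains -> chains} := seqbd \o consn U.
pose g : {linear chains -> chains} := idfun \- (consn U \o seqbd).
move=> sc; apply: (@eq_supported _ _ _ f g _ _ sc) => /= -[_|W s].
  rewrite /f /g /= consnU /= seqbd_cons seqbdU.
  by rewrite (linear0 (consl U)) (linear0 (consn U)).
case/and3P => WU W0 fs; rewrite /f /g /= consnU.
case: ifP => [/eqP[WU1]|/negbT nWU].
  rewrite -{U sc f g WU}WU1.
  have nhs : ohead s == Some W = false.
    case: s fs => //= W' s /andP[/andP[W'W _] _].
    by apply/eqP => -[WW']; rewrite WW' ltxx in W'W.
  rewrite (linear0 seqbd) seqbd_cons (linearB (consn W)) consnU nhs.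
  by rewrite consn_consl subr0 subrr.
rewrite seqbd_cons; congr (_ - _); rewrite seqbd_cons.
rewrite (linearB (consl U)) (linearB (consn U)) consnU conslU.
have -> : ohead s == Some U = false.
  case: s fs {nWU} => //= W' s /andP[/andP[W'W _] _].
  by apply/eqP => -[UW']; have := lt_le_trans W'W WU; rewrite UW' ltxx.
congr (_ - _).
pose f1 : {linear chains -> chains} := consl U \o consl W.
pose g1 : {linear chains -> chains} := consn U \o consl W.
apply: (@eq_linear_basis _ _ _ f1 g1) => t.
by rewrite /f1 /g1 /= !conslU consnU /= (negPf nWU).
Qed.

Section Cone.
Variable L : T.

(** The prism operator of W <= W + L >= L.  Unfolded, it is the alternating sum
    of the words W_0 + L, .., W_i + L, W_i, .., W_q and of the last word
    W_0 + L, .., W_q + L, L, with degenerate words dropped. *)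
Fixpoint cone s : chains :=
  if s is W :: s' then
    consn (W `|` L) << s >> - consn (W `|` L) (cone s')
  else << [:: L] >>.

Definition apex s := if s is W :: _ then W `|` L else L.

Lemma cone_supported V s : L != \bot -> flag V s ->
  supported (fun t => wflag (apex s) t && (size t == (size s).+1)) (cone s).
Proof.
move=> L0; elim: s V => [|W s IHs] V /=.
  by move=> _; apply: supportedU => /=; rewrite lexx L0.
case/andP=> /andP[WV W0] fs.
have WL0 : W `|` L != \bot.
  by apply: contraNneq W0 => WL0; rewrite -lex0 -WL0 leUl.
have stp k t : wflag (W `|` L) t && (size t == k) ->
    ohead t != Some (W `|` L) ->
    wflag (W `|` L) (W `|` L :: t) && (size (W `|` L :: t) == k.+1).
  case/andP=> ft /eqP <- nt; rewrite /= lexx WL0 eqxx andbT /=.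
  case: t ft nt => //= W' t /and3P[W'W W'0 ->] nW'.
  by rewrite /above W'0 lt_neqAle W'W !andbT; apply: contraNneq nW' => ->.
have WWL : W <= W `|` L by apply: leUl.
apply: supportedD; last apply: supportedN.
  apply: (consn_supported (P := fun t => wflag (W `|` L) t &&
    (size t == (size s).+1))); last exact: stp.
  by apply: supportedU; rewrite /= eqxx WWL W0 fs.
apply: (consn_supported (P := fun t => wflag (W `|` L) t &&
  (size t == (size s).+1))); last exact: stp.
apply: supported_sub (IHs _ fs) => t /andP[ft ->]; rewrite andbT.
apply: wflagS ft; case: s fs {IHs} => /= [_|W' s]; first exact: leUr.
by case/andP=> /andP[/ltW W'W _] _; apply: leU2.
Qed.

Lemma cone_norm s : l1norm (cone s) <= (size s).+1%:R.
Proof.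
elim: s => [|W s IHs] /=; first by rewrite l1normU.
rewrite (le_trans (l1normD _ _)) // l1normN -natr1 addrC lerD //.
  exact: le_trans (consn_norm _ _) _.
by rewrite (le_trans (consn_norm _ _)) // l1normU.
Qed.

Lemma lin_cone_consl W c : lin_ext cone (consl W c) =
  consn (W `|` L) (consl W c) - consn (W `|` L) (lin_ext cone c).
Proof.
pose f : {linear chains -> chains} := lin_ext cone \o consl W.
pose g : {linear chains -> chains} :=
  (consn (W `|` L) \o consl W) \- (consn (W `|` L) \o lin_ext cone).
apply: (@eq_linear_basis _ _ _ f g) => t.
by rewrite /f /g /= conslU !(lin_extU cone).
Qed.

(** With U = W + L, d (U W s - U cone s) is
    W s - U d (W s) - cone s + U d (cone s), and the induction hypothesis for s
    turns this into W s - cone (d (W s)). *)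
Lemma cone_contracts V s : L != \bot -> flag V s ->
  seqbd (cone s) + lin_ext cone (seqbd << s >>) = << s >>.
Proof.
move=> L0; elim: s V => [|W s IHs] V.
  move=> _; rewrite /= seqbd_cons !seqbdU.
  by rewrite (linear0 (consl L)) (linear0 (lin_ext cone)) addr0 subr0.
case/andP=> /andP[WV W0] fs; rewrite [cone (W :: s)]/=.
rewrite (linearB seqbd) /= !seqbd_consn; first last.
- by apply: supportedU; apply/and3P; split=> //; apply: leUl.
- apply: supported_sub (cone_supported L0 fs) => t /andP[ft _].
  apply: wflagS ft; case: s fs {IHs} => /= [_|W' s]; first exact: leUr.
  by case/andP=> /andP[/ltW W'W _] _; apply: leU2.
(* The induction hypothesis is used to eliminate s itself, after which all terms
   cancel in pairs. *)
have /eqP := IHs _ fs; rewrite eq_sym -subr_eq => /eqP <-.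
rewrite seqbd_cons !(linearB (lin_ext cone)) lin_cone_consl lin_extU.
rewrite !(linearB (consn _)).
by rewrite !opprB !addrA !subrK addrK.
Qed.

End Cone.

Variables (rank : T -> nat) (atom : T -> T).
Hypotheses (rank_bot : rank \bot = 0%N)
  (rank_lt : forall x y, x < y -> (rank x < rank y)%N)
  (atom_le : forall x, atom x <= x)
  (atom_neq_bot : forall x, x != \bot -> atom x != \bot)
  (rank_join_atom : forall x y, (rank (y `|` atom x) <= (rank y).+1)%N).

Lemma flag_size V s : flag V s -> (size s <= (rank V).-1)%N.
Proof.
elim: s V => //= W s IHs V /andP[/andP[WV W0] /IHs].
have : (rank \bot < rank W)%N by rewrite rank_lt // lt0x.
have := rank_lt WV; lia.
Qed.

(** The homotopy h_V, meant for n = rank V; in the transverse case the rank of W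
    is n - 1, which is why the recursion can be on n. *)
Fixpoint contract n V s : chains :=
  if n isn't n'.+1 then 0 else
  if s is W :: s' then
    if W `|` atom V == V then
      lin_ext (cone (atom V)) (contract n' W s') - consl W (contract n' W s')
    else cone (atom V) s
  else cone (atom V) s.

(** Only the head needs a test: the other members lie strictly below it, hence
    have corank at least two and cannot be complements of an atom. *)
Definition transverse V s := if s is W :: _ then W `|` atom V == V else false.

Lemma contract_cone n V s : ~~ transverse V s ->
  contract n.+1 V s = cone (atom V) s.
Proof. by case: s => //= W s /negPf ->. Qed.

Lemma lin_contract_consl n V W c : lin_ext (contract n.+1 V) (consl W c) =
  if W `|` atom V == V then
    lin_ext (cone (atom V)) (lin_ext (contract n W) c) -
    consl W (lin_ext (contract n W) c)
  else lin_ext (cone (atom V)) (consl W c).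
Proof.
case: ifPn => hW.
  pose f : {linear chains -> chains} := lin_ext (contract n.+1 V) \o consl W.
  pose g : {linear chains -> chains} :=
    (lin_ext (cone (atom V)) \o lin_ext (contract n W)) \-
    (consl W \o lin_ext (contract n W)).
  apply: (@eq_linear_basis _ _ _ f g) => t.
  rewrite /f /g /= conslU (lin_extU (contract n.+1 V)).
  by rewrite (lin_extU (contract n W)) /= hW.
pose f : {linear chains -> chains} := lin_ext (contract n.+1 V) \o consl W.
pose g : {linear chains -> chains} := lin_ext (cone (atom V)) \o consl W.
apply: (@eq_linear_basis _ _ _ f g) => t.
rewrite /f /g /= conslU (lin_extU (contract n.+1 V)).
by rewrite (lin_extU (cone _)) contract_cone.
Qed.

Lemma transverse_rank V W : W < V -> W `|` atom V = V -> rank V = (rank W).+1.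
Proof.
by move=> /rank_lt + WLV; have := rank_join_atom V W; rewrite WLV; lia.
Qed.

Section Step.
Variable V : T.
Hypothesis rankV : (1 < rank V)%N.

Lemma atom_lt : atom V < V.
Proof.
rewrite lt_neqAle atom_le andbT.
have := rank_join_atom V \bot; rewrite join0x rank_bot.
by apply: contraTneq => ->; lia.
Qed.

Lemma atomV_neq_bot : atom V != \bot.
Proof.
by apply: atom_neq_bot; apply: contraTneq rankV => ->; rewrite rank_bot.
Qed.

Lemma cone_flag s : flag V s -> ~~ transverse V s ->
  supported (fun t => flag V t && (size t == (size s).+1)) (cone (atom V) s).
Proof.
move=> fs ns; apply: supported_sub (cone_supported atomV_neq_bot fs).
move=> t /andP[ft ->]; rewrite andbT; apply: wflag_flag ft.
case: s fs ns => /= [_ _|W s]; first exact: atom_lt.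
case/andP=> /andP[/ltW WV _] _ nW.
by rewrite lt_neqAle nW leUx WV atom_le.
Qed.

Lemma flag_below W s : W < V -> flag W s -> flag V s && ~~ transverse V s.
Proof.
move=> WV fs; apply/andP; split; first exact/(wflag_flag WV)/flag_wflag.
case: s fs => //= W' s /andP[/andP[W'W _] _]; apply/eqP => W'L.
have := transverse_rank (lt_trans W'W WV) W'L.
by have := rank_lt W'W; have := rank_lt WV; lia.
Qed.

End Step.

(** The range size s + 2 <= n is preserved when the head of the flag and one
    unit of rank are removed together; it starts with the empty flag in rank
    two, where the atom lies strictly below V.  For transverse W, writing
    t = h_W s,
      d (cone t - W t) = (t - cone (d t)) - (t - W (d t))
    because t lies in the subcomplex contracted by [cone], and
    h_V (d (W s)) = cone s - cone (h_W (d s)) + W (h_W (d s)); the sum is W s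
    once d t + h_W (d s) = s is inserted.  If W has rank m, this step multiplies
    the norm by at most m + 2: m + 1 from the cone and one from prepending W. *)
Theorem contract_contracts n V s :
  rank V = n -> flag V s -> (size s + 2 <= n)%N ->
  [/\ supported (fun t => flag V t && (size t == (size s).+1)) (contract n V s),
      l1norm (contract n V s) <= (n.+1)`!%:R
    & seqbd (contract n V s) + lin_ext (contract n V) (seqbd << s >>) =
      << s >>].
Proof.
elim: n V s => [|n IHn] V s rV fs sz; first by move: sz; rewrite addn2.
have rV1 : (1 < rank V)%N by lia.
have L0 := atomV_neq_bot rV1.
have [trs|ntrs] := boolP (transverse V s); last first.
  rewrite contract_cone //; split; first exact: cone_flag.
    apply: le_trans (cone_norm _ _) _; rewrite ler_nat.
    by apply: leq_trans (fact_geq _); lia.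
  rewrite -[RHS](cone_contracts L0 fs); congr (_ + _).
  case: s fs ntrs {sz} => [|W s] fs ntrs.
    rewrite seqbdU /= (linear0 (lin_ext (contract n.+1 V))).
    by rewrite (linear0 (lin_ext (cone _))).
  case/andP: fs => /andP[WV _] fs.
  rewrite seqbd_cons (linearB (lin_ext (contract n.+1 V))).
  rewrite (linearB (lin_ext (cone _))) lin_contract_consl ifN //.
  rewrite (lin_extU (contract n.+1 V)) (lin_extU (cone _)).
  by case/andP: (flag_below rV1 WV fs) => _ /contract_cone ->.
case: s fs trs sz => // W s fs trs sz; move: (fs) => /andP[/andP[WV W0] fWs].
have rW : rank W = n by have := transverse_rank WV (eqP trs); lia.
have [sW nW cW] := IHn W s rW fWs ltac:(move: sz => /=; lia).
have -> : contract n.+1 V (W :: s) =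
    lin_ext (cone (atom V)) (contract n W s) - consl W (contract n W s).
  by rewrite /= ifT.
(* A flag below W has no transverse member for V, so the cone applies to it. *)
have sV : supported
    (fun t => [&& flag V t, ~~ transverse V t & size t == (size s).+1])
    (contract n W s).
  by apply: supported_sub sW => t /andP[/(flag_below rV1 WV) /andP[-> ->] ->].
set t := contract n W s in sW nW cW sV *; split.
- apply: supportedD; last apply: supportedN.
    apply: (supported_lin_ext sV) => r /and3P[fr nr /eqP rs].
    by rewrite -[size (W :: s)]/(size s).+1 -rs; apply: cone_flag.
  apply: (consl_supported sW) => r /andP[fr /eqP rs].
  by rewrite /= rs eqxx andbT; apply/andP; split; first exact/andP.
- apply: le_trans (l1normD _ _) _; rewrite l1normN.
  have h1 : l1norm (lin_ext (cone (atom V)) t) <= n.+1%:R * l1norm t.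
    apply: (l1norm_lin_ext_supported sV) => r /and3P[_ _ /eqP rs].
    apply: le_trans (cone_norm _ _) _; rewrite ler_nat rs.
    by move: sz => /=; lia.
  apply: le_trans (lerD h1 (consl_norm _ _)) _.
  rewrite -[X in _ + X]mul1r -mulrDl natr1 factS natrM.
  by rewrite ler_wpM2l.
rewrite (linearB seqbd) seqbd_consl seqbd_cons.
rewrite (linearB (lin_ext (contract n.+1 V))) lin_contract_consl ifT //.
have [_ /contract_cone cs] := andP (flag_below rV1 WV fWs).
rewrite (lin_extU (contract n.+1 V)) cs.
have -> : seqbd (lin_ext (cone (atom V)) t) =
    t - lin_ext (cone (atom V)) (seqbd t).
  pose f : {linear chains -> chains} := seqbd \o lin_ext (cone (atom V)).
  pose g : {linear chains -> chains} :=
    idfun \- (lin_ext (cone (atom V)) \o seqbd).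
  apply: (@eq_supported _ _ _ f g _ _ sV) => r /and3P[fr _ _].
  rewrite /f /g /= (lin_extU (cone _)); apply/eqP.
  by rewrite eq_sym subr_eq (cone_contracts L0 fr).
(* Eliminate h_W (d s) in favour of d t. *)
have /eqP := cW; rewrite eq_sym addrC -subr_eq => /eqP <-.
rewrite (linearB (lin_ext (cone _))) (linearB (consl W)) lin_extU conslU.
set X := lin_ext (cone _) _; set Y := consl W _; set C := cone _ s.
rewrite !opprB.
have -> : C + (<< W :: s >> - Y + (X - C)) = << W :: s >> - Y + X.
  by rewrite addrC -addrA subrK.
have -> : t - X + (Y - t) = Y - X by rewrite addrC addrA subrK.
by rewrite addrC -addrA [X + _]addrC subrK subrK.
Qed.

End Contraction.

(** * Bounded contractions of normed complexes *)

Section Homotopy.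
Variables (R : realType) (C : normedComplex R).
Variable h : forall k, {linear C k -> C k.+1}.

Definition lower_homotopy k : C k -> C k :=
  match k with
  | 0 => fun=> 0
  | k'.+1 => fun c => h k' (bd c)
  end.

(** In index 0 there is no lower term, so this makes [h 0] a section of the
    augmentation when the complex is reduced. *)
Definition contracts_at k := forall c : C k, bd (h k c) + lower_homotopy c = c.

Lemma cnormN k (c : C k) : cnorm (- c) = cnorm c.
Proof. by rewrite -scaleN1r cnormZ normrN1 mul1r. Qed.

Lemma cnorm_ge0 k (c : C k) : 0 <= cnorm c.
Proof.
have := cnormD c (- c); rewrite cnormN subrr.
rewrite -[X in cnorm X](scale0r (0 : C k)) cnormZ normr0 mul0r.
by rewrite -mulr2n pmulrn_lge0.
Qed.

Lemma contracts_cycle k (c : C k) :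
  contracts_at k -> is_cycle c -> bd (h k c) = c.
Proof.
case: k c => [|k] c /(_ c) /= hc; first by rewrite addr0 in hc.
by move=> bc; rewrite -[RHS]hc bc linear0 addr0.
Qed.

Lemma contracts_homology k : contracts_at k -> homology_vanishes C k.
Proof. by move=> hk c /(contracts_cycle hk) hc; exists (h k c). Qed.

Lemma contracts_UBC k (K : R) : contracts_at k ->
  (forall c : C k, cnorm (h k c) <= K * cnorm c) -> UBC C k K.
Proof.
move=> hk hK s [b bs]; exists (h k s); split=> //; apply: contracts_cycle => //.
by case: k hk hK s b bs => //= k hk hK s b <-; apply: bd_bd.
Qed.

(** For a cocycle f, f c = f (bd (h c)) + f (h (bd c)) = (f o h) (bd c). *)
Lemma contracts_bcohomology k (K : R) : contracts_at k ->
  (forall j (c : C j), (j <= k)%N -> cnorm (h j c) <= K * cnorm c) ->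
  bcohomology_vanishes C k.
Proof.
case: k => [|k] hk hK f [[M fM] f0].
  by move=> c; rewrite -[c]hk /= addr0 f0.
exists (f \o h k); split=> [|c]; last by rewrite -[c in LHS]hk linearD f0 add0r.
exists (`|M| * K) => c /=; apply: (le_trans (fM _)).
apply: le_trans (ler_wpM2r (cnorm_ge0 _) (ler_norm M)) _.
by rewrite -mulrA ler_wpM2l // hK.
Qed.

End Homotopy.

(** * Simplices of an order complex as decreasing words *)

Section Line.
Variables (R : realType) (V : lmodType R) (v : V).

Definition line_fun (a : R^o) : V := (a : R) *: v.

Lemma line_is_linear : linear line_fun.
Proof. by move=> a b c; rewrite /line_fun scalerDl scalerA. Qed.

HB.instance Definition _ :=
  GRing.isLinear.Build R R^o V _ line_fun line_is_linear.

Definition line : {linear R^o -> V} := line_fun.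
End Line.

Section Words.
Variables (R : realType) (dP dT : Order.disp_t).
Variables (P : porderType dP) (T : bJoinSemilatticeType dT).
Variables (f : P -> T) (V : T).
Hypotheses (f_mono : {mono f : x y / (x <= y)%O})
  (f_above : forall x, above V (f x))
  (f_surj : forall W, above V W -> exists x, f x = W).
Local Notation chains := {malg R[seq T]}.
Local Notation X := (order_complex P).

(** A simplex lists its vertices in increasing order and a flag in decreasing
    order; the reversal is the source of the signs (-1)^k below. *)
Definition word q (x : ochain P q) : seq T :=
  [seq f (val x (rev_ord i)) | i <- enum 'I_q.+1].

Lemma size_word q (x : ochain P q) : size (word x) = q.+1.
Proof. by rewrite size_map size_enum_ord. Qed.

Lemma nth_word q (x : ochain P q) (i : 'I_q.+1) :
  nth \bot%O (word x) i = f (val x (rev_ord i)).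
Proof. by rewrite (nth_map ord0) ?size_enum_ord // nth_ord_enum. Qed.

Lemma word_inj q : injective (@word q).
Proof.
have f_inj : injective f := inc_inj f_mono.
move=> x y xy; apply/val_inj/ffunP => i; apply: f_inj.
by rewrite -[i]rev_ordK -!nth_word xy.
Qed.

Lemma word_flag q (x : ochain P q) : flag V (word x).
Proof.
rewrite /flag path_min_sorted; last first.
  by apply/allP => _ /mapP[i _ ->]; apply: f_above.
rewrite (sorted_pairwise (@above_trans _ _)); apply/(pairwiseP \bot%O).
move=> i j; rewrite !inE size_word => lti ltj ltij.
rewrite (nth_word x (Ordinal lti)) (nth_word x (Ordinal ltj)).
have /andP[_ fj0] := f_above (val x (rev_ord (Ordinal ltj))).
rewrite /above fj0 andbT (leW_mono f_mono).
have /forallP/(_ (rev_ord (Ordinal ltj)))/forallP/(_ (rev_ord (Ordinal lti))) :=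
  valP x.
by move/implyP; apply => /=; lia.
Qed.

Lemma word_surj q s : flag V s -> size s = q.+1 ->
  exists x : ochain P q, word x = s.
Proof.
move=> fs sz.
have abv i : (i < size s)%N -> above V (nth \bot%O s i).
  move=> lti; apply: (allP (order_path_min (@above_trans _ _) fs)).
  exact: mem_nth.
have ex (i : 'I_q.+1) : exists x, f x = nth \bot%O s (rev_ord i).
  by apply/f_surj/abv; rewrite sz.
pose x : {ffun 'I_q.+1 -> P} := [ffun i => projT1 (cid (ex i))].
have xE i : f (x i) = nth \bot%O s (rev_ord i) by rewrite ffunE; case: cid.
have cx : is_chain x.
  apply/forallP => i; apply/forallP => j; apply/implyP => ij.
  rewrite -(leW_mono f_mono) !xE.
  have /andP[] // : above (nth \bot%O s (rev_ord j)) (nth \bot%O s (rev_ord i)).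
  apply: (sorted_ltn_nth (@above_trans _ _)) => //; rewrite ?inE ?sz //=.
  - exact: path_sorted fs.
  - lia.
  - lia.
  - have := ltn_ord j; lia.
exists (Sub x cx : ochain P q).
apply: (@eq_from_nth _ \bot%O); rewrite size_word ?sz // => i lti.
by rewrite (nth_word _ (Ordinal lti)) /= xE rev_ordK.
Qed.

Lemma word_face q (k : 'I_q.+2) (x : ochain P q.+1) :
  word (oface k x) = del (rev_ord k) (word x).
Proof.
have ltk : (rev_ord k < size (word x))%N by rewrite size_word.
apply: (@eq_from_nth _ \bot%O); first by rewrite size_del // !size_word.
move=> i; rewrite size_word => lti; rewrite nth_del //.
rewrite (nth_word _ (Ordinal lti)) ffunE.
rewrite -[bump _ _]/(nat_of_ord (lift (rev_ord k) (Ordinal lti))) nth_word.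
congr (f (val x _)); apply: val_inj; rewrite /= /bump.
have := ltn_ord k; lia.
Qed.

Definition words k : {linear rchain R X k -> chains} :=
  match k with
  | 0 => line << [::] >>
  | q.+1 => lin_ext (fun x : ochain P q => << word x >> : chains)
  end.

Lemma words_bd k (c : rchain R X k.+1) :
  words k (rbd R X k c) = (-1) ^+ k *: seqbd (words k.+1 c).
Proof.
pose F : {linear {malg R[X k]} -> chains} := words k \o rbd R X k.
pose G : {linear {malg R[X k]} -> chains} :=
  (-1) ^+ k \*: (seqbd \o words k.+1).
apply: (@eq_linear_basis _ _ _ F G) => {c} x.
rewrite /F /G /= lin_extU seqbd_del size_word.
case: k x {F G} => [|k] x.
  rewrite /augmentation lin_extU /= /line_fun !scale1r big_ord1 !scale1r.
  by congr << _ >>; apply/esym/size0nil; rewrite size_del ?size_word.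
rewrite [rbd R X k.+1]/(rbd R X k.+1) sbdU linear_sum scaler_sumr.
rewrite [RHS](reindex_inj rev_ord_inj); apply: eq_bigr => i _.
rewrite linearZ /= lin_extU word_face scalerA -exprD; congr (_ *: _).
rewrite -[LHS]signr_odd -[RHS]signr_odd; congr (_ ^+ nat_of_bool _).
have := ltn_ord i; lia.
Qed.

Lemma words_supported k (c : rchain R X k) :
  supported (fun s => flag V s && (size s == k)) (words k c).
Proof.
case: k c => [|k] c; first by apply/supportedZ/supportedU.
apply: (@supported_lin_ext _ _ _ predT) => // x _; apply: supportedU.
by rewrite word_flag size_word /=.
Qed.

Lemma words_norm k (c : rchain R X k) : l1norm (words k c) <= rnorm c.
Proof.
case: k c => [|k] c; first by rewrite /= /line_fun l1normZ l1normU mulr1.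
rewrite -[leRHS]mul1r; apply: l1norm_lin_ext => x.
by rewrite l1normU.
Qed.

(** A left inverse of [words] on all chains, and a right inverse on the chains
    of flags ([unwordK]); only its values on flags matter. *)
Definition unword q : {linear chains -> {malg R[X q]}} :=
  lin_ext (fun s => if pselect (exists x : ochain P q, word x = s) is left e
                    then << projT1 (cid e) >> else 0 : {malg R[ochain P q]}).

Lemma unwordK q c : supported (fun s => flag V s && (size s == q.+1)) c ->
  words q.+1 (unword q c) = c.
Proof.
pose F : {linear chains -> chains} := words q.+1 \o unword q.
pose G : {linear chains -> chains} := idfun.
move=> sc; apply: (@eq_supported _ _ _ F G _ _ sc) => s /andP[fs /eqP sz].
rewrite /F /G /= /unword lin_extU; case: pselect => [e|[]].
  rewrite (lin_extU (fun x : ochain P q => << word x >> : chains)).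
  by case: cid => x /= ->.
exact: word_surj.
Qed.

Lemma words_inj k : injective (words k).
Proof.
case: k => [a b|k] /=.
  move/(congr1 (mcoeff [::])).
  by rewrite /line_fun !mcoeffZ mcoeffUU !mulr1.
apply: (can_inj (g := unword k)) => c.
pose F : {linear {malg R[X k]} -> {malg R[X k]}} := unword k \o words k.+1.
apply: (@eq_linear_basis _ _ _ F idfun) => x.
rewrite /F /= (lin_extU (fun x : ochain P k => << word x >> : chains)).
rewrite /unword lin_extU.
case: pselect => [e|[]]; last by exists x.
by case: cid => y /= /word_inj ->.
Qed.

Lemma unword_norm q c : l1norm (unword q c) <= l1norm c.
Proof.
rewrite -[leRHS]mul1r; apply: l1norm_lin_ext => s.
by case: pselect => e; rewrite ?l1norm0 ?l1normU.
Qed.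

Variables (rank : T -> nat) (atom : T -> T).
Hypotheses (rank_bot : rank \bot%O = 0%N)
  (rank_lt : forall x y, (x < y)%O -> (rank x < rank y)%N)
  (atom_le : forall x, (atom x <= x)%O)
  (atom_neq_bot : forall x, x != \bot%O -> atom x != \bot%O)
  (rank_join_atom : forall x y, (rank (y `|` atom x)%O <= (rank y).+1)%N).

Let contr := contract R atom (rank V) V.

(** The sign cancels the one that [words_bd] produces. *)
Definition flag_homotopy k : {linear rchain R X k -> rchain R X k.+1} :=
  (-1) ^+ k \*: (unword k \o (lin_ext contr \o words k)).

Lemma contr_words k (c : rchain R X k) : (k + 2 <= rank V)%N ->
  [/\ supported (fun s => flag V s && (size s == k.+1))
        (lin_ext contr (words k c)),
      l1norm (lin_ext contr (words k c)) <= ((rank V).+1)`!%:R * rnorm c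
    & seqbd (lin_ext contr (words k c)) + lin_ext contr (seqbd (words k c)) =
      words k c].
Proof.
move=> lek.
have hc s : flag V s && (size s == k) ->
    [/\ supported (fun t => flag V t && (size t == k.+1)) (contr s),
        l1norm (contr s) <= ((rank V).+1)`!%:R
      & seqbd (contr s) + lin_ext contr (seqbd << s >>) = << s >>].
  case/andP=> fs /eqP sz; rewrite -sz in lek *.
  exact: contract_contracts rank_bot rank_lt atom_le atom_neq_bot
    rank_join_atom _ _ _ (erefl _) fs lek.
have sc := @words_supported k c; split.
- by apply: (supported_lin_ext sc) => s /hc[].
- apply: le_trans (ler_wpM2l _ (words_norm c)) => //.
  by apply: (l1norm_lin_ext_supported sc) => s /hc[].
pose F : {linear chains -> chains} :=
  (seqbd \o lin_ext contr) \+ (lin_ext contr \o seqbd).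
apply: (@eq_supported _ _ _ F idfun _ _ sc) => s /hc[_ _ e].
by rewrite /F /= (lin_extU contr).
Qed.

Let C := reducedComplex R X.
Let h : forall k, {linear C k -> C k.+1} := flag_homotopy.

Lemma flag_homotopy_norm k (c : C k) : (k + 2 <= rank V)%N ->
  cnorm (h k c) <= ((rank V).+1)`!%:R * cnorm c.
Proof.
move=> lek; have [_ nc _] := contr_words c lek.
rewrite -[cnorm _]/(l1norm ((-1) ^+ k *: unword k (lin_ext contr (words k c)))).
rewrite l1normZ normrX normrN1 expr1n mul1r.
exact: le_trans (unword_norm _ _) nc.
Qed.

Lemma words_homotopy k (c : C k) : (k + 2 <= rank V)%N ->
  words k.+1 (h k c) = (-1) ^+ k *: lin_ext contr (words k c).
Proof.
move=> lek; have [sc _ _] := contr_words c lek.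
rewrite -[h k c]/((-1) ^+ k *: unword k (lin_ext contr (words k c))).
by rewrite (linearZZ (words k.+1)); congr (_ *: _); apply: unwordK.
Qed.

Lemma flag_homotopy_contracts k : (k + 2 <= rank V)%N -> contracts_at h k.
Proof.
move=> lek c; apply: words_inj; have [_ _ e] := contr_words c lek.
have sign2 j (d : chains) : (-1) ^+ j *: ((-1) ^+ j *: d) = d.
  by rewrite scalerA -exprD addnn -signr_odd odd_double scale1r.
rewrite (linearD (words k)) -[RHS]e; congr (_ + _).
  by rewrite [LHS]words_bd words_homotopy // (linearZZ seqbd) sign2.
case: k lek c {e} => [|k] lek c.
  rewrite /= (_ : words 0 0 = 0); last exact: (linear0 (words 0)).
  rewrite -[line _ _]/(line_fun _ _) /line_fun (linearZZ seqbd) seqbdU.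
  by rewrite scaler0 linear0.
rewrite [LHS]words_homotopy; last by lia.
by rewrite words_bd (linearZZ (lin_ext contr)) sign2.
Qed.

Lemma interval_acyclic k : (k + 2 <= rank V)%N ->
  [/\ homology_vanishes C k, UBC C k ((rank V).+1)`!%:R
    & bcohomology_vanishes C k].
Proof.
move=> lek; have hk := flag_homotopy_contracts lek; split.
- exact: contracts_homology hk.
- by apply: (contracts_UBC hk) => c; apply: flag_homotopy_norm.
- apply: (contracts_bcohomology (K := ((rank V).+1)`!%:R) hk) => j c lej.
  by apply: flag_homotopy_norm; lia.
Qed.

Lemma bcohomology_above_rank k : (0 < k)%N -> (rank V <= k)%N ->
  bcohomology_vanishes C k.
Proof.
case: k => // q _ leq g _; exists \0; split=> [|c].
  by exists 0 => c; rewrite /= normr0 mul0r.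
apply: (@linear_ext0 R (X q) R^o g) => x.
have := flag_size rank_bot rank_lt (word_flag x); rewrite size_word.
by move: leq; clear; lia.
Qed.

End Words.

(** * The lattice of subspaces *)

(** An alias, so that the inclusion order lives on this type only. *)
Definition subspaces (K : fieldType) n : Type := {vspace 'rV[K]_n}.

Section Subspaces.
Variables (K : fieldType) (n : nat).
Local Notation T := (subspaces K n).

HB.instance Definition _ := Choice.copy T {vspace 'rV[K]_n}.

Definition subspaces_le (U W : T) : bool := (U <= W)%VS.

Lemma subspaces_le_refl : reflexive subspaces_le.
Proof. by move=> U; apply: subvv. Qed.

Lemma subspaces_le_anti : antisymmetric subspaces_le.
Proof. by move=> U W; apply: subv_anti. Qed.

Lemma subspaces_le_trans : transitive subspaces_le.
Proof. by move=> W U V; apply: subv_trans. Qed.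

HB.instance Definition _ := Order.Le_isPOrder.Build tits_display T
  subspaces_le_refl subspaces_le_anti subspaces_le_trans.

Definition subspaces_join (U W : T) : T := (U + W)%VS.

Lemma subspaces_leUx (U W Z : T) :
  (subspaces_join U W <= Z)%O = (U <= Z)%O && (W <= Z)%O.
Proof. exact: subv_add. Qed.

HB.instance Definition _ :=
  Order.POrder_isJoinSemilattice.Build tits_display T subspaces_leUx.

Lemma subspaces_le0 (U : T) : ((0%VS : T) <= U)%O.
Proof. exact: sub0v. Qed.

HB.instance Definition _ := Order.hasBottom.Build tits_display T subspaces_le0.

Definition line_in (U : T) : T := <[vpick U]>%VS.
Definition sdim (U : T) : nat := \dim U.

Lemma sdim_bot : sdim \bot%O = 0%N. Proof. exact: dimv0. Qed.

Lemma sdim_lt (U W : T) : (U < W)%O -> (sdim U < sdim W)%N.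
Proof.
rewrite lt_neqAle => /andP[nUW UW].
by rewrite (ltn_leqif (dimv_leqif_eq UW)).
Qed.

Lemma line_in_le (U : T) : (line_in U <= U)%O.
Proof. exact: memv_pick. Qed.

Lemma line_in_neq_bot (U : T) : U != \bot%O -> line_in U != \bot%O.
Proof.
move=> U0; have := dim_vline (vpick U); rewrite vpick0 U0 => dl.
by apply/eqP => l0; have := sdim_bot; rewrite -l0 /sdim dl.
Qed.

Lemma sdim_join_line (U W : T) : (sdim (W `|` line_in U)%O <= (sdim W).+1)%N.
Proof.
apply: (leq_trans (dimv_add_leqif W (line_in U))).
by rewrite dim_vline (leq_trans (leq_add (leqnn _) (leq_b1 _))) // addn1.
Qed.

Definition tits_val (U : tits K n) : T := val U.

Lemma tits_val_mono : {mono tits_val : U W / (U <= W)%O}.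
Proof. by []. Qed.

Lemma above_fullE (W : T) :
  above (fullv : T) W = proper_nontrivial (W : {vspace 'rV[K]_n}).
Proof.
rewrite /above /proper_nontrivial andbC; congr (_ && _).
rewrite lt_neqAle (_ : (W <= (fullv : T))%O) ?andbT //.
exact: subvf.
Qed.

Lemma tits_val_above U : above (fullv : T) (tits_val U).
Proof. by rewrite above_fullE; apply: valP. Qed.

Lemma tits_val_surj (W : T) : above (fullv : T) W -> exists U, tits_val U = W.
Proof. rewrite above_fullE => pW.
by exists (exist (fun U => is_true (proper_nontrivial U)) W pW). Qed.

Lemma sdim_full : sdim fullv = n.
Proof. by rewrite /sdim dimvf dim_matrix; apply: mul1n. Qed.

End Subspaces.

(** * Tits buildings *)

Theorem theorem8p2 (R : realType) :
  exists KT : nat -> R, forall (K : fieldType) (n : nat),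
    [/\ uniformly_acyclic R (tits_building K n) (n%:Z - 3),
        forall q : nat, q%:Z <= n%:Z - 3 ->
          sset_UBC (tits_building K n) q (KT n)
      & forall q : int, q <> n%:Z - 2 -> ~ (n = 0%N /\ q = - 1) ->
          reduced_bcohomology_vanishes R (tits_building K n) q].
Proof.
exists (fun n => (n.+1)`!%:R) => K n.
have := @interval_acyclic R _ _ (tits K n) (subspaces K n) (@tits_val K n)
  fullv (@tits_val_mono K n) (@tits_val_above K n) (@tits_val_surj K n)
  (@sdim K n) (@line_in K n) (sdim_bot K n) (@sdim_lt K n) (@line_in_le K n)
  (@line_in_neq_bot K n) (@sdim_join_line K n).
have := @bcohomology_above_rank R _ _ (tits K n) (subspaces K n) (@tits_val K n)
  fullv (@tits_val_mono K n) (@tits_val_above K n)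
  (@sdim K n) (sdim_bot K n) (@sdim_lt K n).
rewrite sdim_full => high low; split.
- move=> n2; have n0 : (0 + 2 <= n)%N by lia.
  split=> [|q qn].
    have [/(_ (1 : R^o) I)[b b1] _ _] := low _ n0.
    have [//|noX] := pselect (inhabited (tits_building K n 0%N)).
    have b0 : augmentation R (tits_building K n) b = 0.
      by apply: linear_ext0 => x; case: noX; exact: inhabits x.
    by have /eqP := etrans (esym b0) b1; rewrite eq_sym oner_eq0.
  have qn1 : (q.+1 + 2 <= n)%N by lia.
  have [hq uq _] := low _ qn1; split=> //; exists (n.+1)`!%:R; exact: uq.
- move=> q qn; have qn1 : (q.+1 + 2 <= n)%N by lia.
  by have [_ uq _] := low _ qn1; exact: uq.
move=> q qn qn0 k kq.
have [kn|nk] := leqP (k + 2)%N n; first by case: (low _ kn).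
apply: high; last by lia.
by rewrite lt0n; apply/eqP => k0; apply: qn0; lia.
Qed.
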